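(* Let $I$ and $J$ be open intervals of $\mathbb{R}$ and let $f(x,y)$ be a smooth function on $I\times J$. The first-order ordinary differential equation $$y' = f(x,y)$$ can be reduced, by a change of the dependent variable $z=z(y)$, to a linear first-order equation $$\frac{dz}{dx} = p(x) + q(x)\,z$$ if and only if it can be written in the form $$y' = T_1(x)\,\xi_1(y) + T_2(x)\,\xi_2(y)$$ such that the operators $$X_1 = \xi_1(y)\frac{\partial}{\partial y},\qquad X_2 = \xi_2(y)\frac{\partial}{\partial y}$$ span a two-dimensional Lie algebra (or a one-dimensional one, if $X_1$ and $X_2$ are linearly dependent).
   Context: All functions are smooth, and $p,q,T_1,T_2$ are functions of $x\in I$ only. A change of the dependent variable $z=z(y)$ is a smooth invertible map with $z'(y)\neq 0$, depending on $y$ only and not on $x$. Changes of variable and representations of the equation are understood locally in $y$, near generic values of $y$: ''can be reduced'' means that there is a nonempty open subinterval $J'\subset J$ and a change of variable $z=z(y)$ defined on $J'$ which transforms the equation, for $x\in I$ and $y\in J'$, into the linear form; ''can be written'' means that there is a nonempty open subinterval $J'\subset J$ and smooth functions $T_1,T_2$ on $I$ and $\xi_1,\xi_2$ on $J'$ such that $f(x,y)=T_1(x)\xi_1(y)+T_2(x)\xi_2(y)$ on $I\times J'$ with the stated property. Linear dependence and spans are over the constants. The commutator is $[X_1,X_2] = (\xi_1\xi_2' - \xi_2\xi_1')\frac{\partial}{\partial y}$; the operators span a Lie algebra if $[X_1,X_2]=\alpha X_1+\beta X_2$ for some constants $\alpha,\beta$. (The Lie algebra spanned by $X_1,X_2$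 is called the Vessiot-Guldberg-Lie algebra of the equation.) *)

(* Defs.v *)
From Stdlib Require Import Reals.
From Coquelicot Require Import Coquelicot.
Open Scope R_scope.

(* Nonempty, possibly unbounded. *)
Definition is_open_interval (S : R -> Prop) : Prop :=
  exists a b : Rbar, Rbar_lt a b /\
    forall x : R, S x <-> Rbar_lt a x /\ Rbar_lt x b.

Definition is_open_subinterval (S' S : R -> Prop) : Prop :=
  is_open_interval S' /\ forall x : R, S' x -> S x.

(* Functions are total on [R]; on an open set [S], smoothness only depends on
   the values taken on [S]. *)
Definition smooth_on (S : R -> Prop) (g : R -> R) : Prop :=
  forall (n : nat) (x : R), S x -> ex_derive_n g n x.

(* All iterated partial derivatives, mixed ones in any order, exist and are
   jointly continuous. *)
Definition smooth2_on (I J : R -> Prop) (f : R -> R -> R) : Prop :=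
  forall (n : nat) (x y : R), I x -> J y -> ex_diff_n f n x y.

(* Injectivity is invertibility onto the image [z(S)]. *)
Definition change_of_variable (S : R -> Prop) (z : R -> R) : Prop :=
  smooth_on S z /\
  (forall y1 y2 : R, S y1 -> S y2 -> z y1 = z y2 -> y1 = y2) /\
  (forall y : R, S y -> Derive z y <> 0).

(* The substitution z = z(y) turns y' = f(x,y) into z' = g(x,z), for x in [I]
   and y in [S]: along any curve x |-> y(x), and at any point x, one equation
   holds exactly when the other does. *)
Definition transforms_into (I S : R -> Prop) (z : R -> R)
    (f g : R -> R -> R) : Prop :=
  forall (y : R -> R) (x : R), I x -> S (y x) -> ex_derive y x ->
    (Derive y x = f x (y x) <->
     Derive (fun t => z (y t)) x = g x (z (y x))).

Definition reducible_to_linear (I J : R -> Prop) (f : R -> R -> R) : Prop :=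
  exists (J' : R -> Prop) (z p q : R -> R),
    is_open_subinterval J' J /\ change_of_variable J' z /\
    smooth_on I p /\ smooth_on I q /\
    transforms_into I J' z f (fun x w => p x + q x * w).

(* In what follows the vector field xi(y) d/dy on [S] is represented by its
   coefficient xi. *)
Definition commutator (xi1 xi2 : R -> R) : R -> R :=
  fun y => xi1 y * Derive xi2 y - xi2 y * Derive xi1 y.

Definition linearly_dependent (S : R -> Prop) (xi1 xi2 : R -> R) : Prop :=
  exists c1 c2 : R, (c1 <> 0 \/ c2 <> 0) /\
    forall y : R, S y -> c1 * xi1 y + c2 * xi2 y = 0.

Definition span_lie_algebra (S : R -> Prop) (xi1 xi2 : R -> R) : Prop :=
  exists alpha beta : R, forall y : R, S y ->
    commutator xi1 xi2 y = alpha * xi1 y + beta * xi2 y.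

Definition span_lie_algebra_dim2 (S : R -> Prop) (xi1 xi2 : R -> R) : Prop :=
  span_lie_algebra S xi1 xi2 /\ ~ linearly_dependent S xi1 xi2.

(* Linearly dependent, but not both zero on [S]. *)
Definition span_lie_algebra_dim1 (S : R -> Prop) (xi1 xi2 : R -> R) : Prop :=
  span_lie_algebra S xi1 xi2 /\ linearly_dependent S xi1 xi2 /\
  exists y : R, S y /\ (xi1 y <> 0 \/ xi2 y <> 0).

Definition has_lie_representation (I J : R -> Prop) (f : R -> R -> R) : Prop :=
  exists (J' : R -> Prop) (T1 T2 xi1 xi2 : R -> R),
    is_open_subinterval J' J /\
    smooth_on I T1 /\ smooth_on I T2 /\
    smooth_on J' xi1 /\ smooth_on J' xi2 /\
    (forall x y : R, I x -> J' y -> f x y = T1 x * xi1 y + T2 x * xi2 y) /\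
    (span_lie_algebra_dim2 J' xi1 xi2 \/ span_lie_algebra_dim1 J' xi1 xi2).

(* Main.v *)
(* Writing [dz/dx = p + q z] in the variable [y] gives [f = (p + q z) / z'], with
   [xi1 = 1 / z'], [xi2 = z / z'] and [[X1, X2] = X1].
   Conversely, near a point where, say, [xi1 <> 0], put [u = xi2 / xi1]: then
   [f = (T1 + T2 u) xi1] and [[X1, X2] = alpha X1 + beta X2] becomes
   [xi1 u' = alpha + beta u].  If [u' = 0] identically, then [u] is constant and
   a primitive [z] of [1 / xi1] satisfies [dz/dx = T1 + u T2].  Otherwise
   [w = alpha + beta u] is nonzero near some point, and [z = u] (if [beta = 0])
   or [z = 1 / w] (if [beta <> 0]) linearizes the equation there. *)

Require Import Defs.
From Stdlib Require Import Reals Lra Classical.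
From Coquelicot Require Import Coquelicot.
Open Scope R_scope.

(** * Open intervals and restriction to smaller ones *)

Lemma open_interval_open (S : R -> Prop) : is_open_interval S -> open S.
Proof.
  intros [a [b [_ H]]].
  apply (open_ext (fun x : R => Rbar_lt a x /\ Rbar_lt x b)).
  - intro x. symmetry. apply H.
  - apply open_and; [apply open_Rbar_gt | apply open_Rbar_lt].
Qed.

(** The bounds are in the [Rmin], [Rmax] form used by [MVT_gen] and [ex_RInt_continuous], so the
    endpoints need not be ordered. *)
Lemma open_interval_between (S : R -> Prop) (x y t : R) :
  is_open_interval S -> S x -> S y -> Rmin x y <= t <= Rmax x y -> S t.
Proof.
  intros [a [b [_ H]]] Hx Hy [H1 H2].
  apply H in Hx. apply H in Hy. apply H. split.
  - apply Rbar_lt_le_trans with (Finite (Rmin x y)); [|exact H1].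
    unfold Rmin. destruct (Rle_dec x y); tauto.
  - apply Rbar_le_lt_trans with (Finite (Rmax x y)); [exact H2|].
    unfold Rmax. destruct (Rle_dec x y); tauto.
Qed.

Lemma open_interval_inhabited (S : R -> Prop) :
  is_open_interval S -> exists x, S x.
Proof.
  intros [a [b [Hab H]]].
  cut (exists x : R, Rbar_lt a x /\ Rbar_lt x b).
  { intros [x Hx]. exists x. now apply H. }
  destruct a as [a| |], b as [b| |]; simpl in *; try contradiction.
  - exists ((a + b) / 2). lra.
  - exists (a + 1). split; [lra|exact I].
  - exists (b - 1). split; [exact I|lra].
  - exists 0. tauto.
Qed.

Lemma open_subinterval_trans (A B C : R -> Prop) :
  is_open_subinterval A B -> is_open_subinterval B C -> is_open_subinterval A C.
Proof. intros [H1 H2] [_ H3]. split; auto. Qed.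

Lemma locally_open_subinterval (S P : R -> Prop) (y0 : R) :
  is_open_interval S -> S y0 -> locally y0 P ->
  exists K, is_open_subinterval K S /\ K y0 /\ forall y, K y -> P y.
Proof.
  intros HS H0 HP.
  destruct (filter_and _ _ HP (open_interval_open S HS y0 H0)) as [e He].
  assert (Hball : forall y, y0 - e < y < y0 + e -> P y /\ S y).
  { intros y Hy. apply He. apply Rabs_def1; unfold minus, plus, opp; simpl; lra. }
  assert (e_pos := cond_pos e).
  exists (fun y => y0 - e < y < y0 + e). split; [split|split].
  - exists (Finite (y0 - e)), (Finite (y0 + e)). split; simpl; [lra|tauto].
  - intros y Hy. now apply Hball.
  - lra.
  - intros y Hy. now apply Hball.
Qed.

Lemma nonzero_open_subinterval (S : R -> Prop) (g : R -> R) (y0 : R) :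
  is_open_interval S -> (forall y, S y -> ex_derive g y) -> S y0 -> g y0 <> 0 ->
  exists K, is_open_subinterval K S /\ K y0 /\ forall y, K y -> g y <> 0.
Proof.
  intros HS Hg H0 Hn.
  apply locally_open_subinterval; trivial.
  apply (ex_derive_continuous g y0 (Hg y0 H0) (fun t => t <> 0)).
  exact (open_neq 0 (g y0) Hn).
Qed.

(** * Closure properties of smooth functions on an open set *)

(* Tracking the order lets [(1/g)' = - g' (1/g)^2] yield smoothness of [1/g] by
   induction. *)
Fixpoint diff_upto (n : nat) (S : R -> Prop) (g : R -> R) : Prop :=
  match n with
  | O => True
  | Datatypes.S m => (forall x, S x -> ex_derive g x) /\ diff_upto m S (Derive g)
  end.

Lemma Derive_n_Derive (g : R -> R) (n : nat) (x : R) :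
  Derive_n (Derive g) n x = Derive_n g (S n) x.
Proof.
  change (Derive g) with (Derive_n g 1). rewrite Derive_n_comp.
  now rewrite Nat.add_comm.
Qed.

(** [Derive_n] adds each new derivative on the outside; this lets the first derivative be peeled off
    on the inside, as [diff_upto] does. *)
Lemma smooth_on_Derive (S : R -> Prop) (g : R -> R) :
  smooth_on S g <-> (forall x, S x -> ex_derive g x) /\ smooth_on S (Derive g).
Proof.
  split.
  - intros H. split.
    + intros x Hx. exact (H 1%nat x Hx).
    + intros [|n] x Hx; [exact I|]. simpl.
      apply ex_derive_ext with (Derive_n g (Datatypes.S n)).
      * intro t. symmetry. apply Derive_n_Derive.
      * exact (H (Datatypes.S (Datatypes.S n)) x Hx).
  (* Order 0 is trivial and order 1 is [H0]; order n + 2 of [g] is order n + 1 of [Derive g]. *)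
  - intros [H0 H] [|[|n]] x Hx; [exact I|exact (H0 x Hx)|].
    change (ex_derive (Derive_n g (Datatypes.S n)) x).
    apply ex_derive_ext with (Derive_n (Derive g) n).
    + intro t. apply Derive_n_Derive.
    + exact (H (Datatypes.S n) x Hx).
Qed.

(** Closure under algebraic operations is proved for each finite order and carried over to
    [smooth_on] by this equivalence. *)
Lemma smooth_on_diff_upto (S : R -> Prop) (g : R -> R) :
  smooth_on S g <-> forall n, diff_upto n S g.
Proof.
  split.
  - intros H n. revert g H. induction n as [|n IH]; intros g H; simpl; [exact I|].
    apply smooth_on_Derive in H. destruct H. auto.
  - intros H n. specialize (H n). revert g H.
    induction n as [|n IH]; intros g H x Hx; [exact I|].
    destruct H as [H0 H]. destruct n as [|n]; [exact (H0 x Hx)|].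
    change (ex_derive (Derive_n g (Datatypes.S n)) x).
    apply ex_derive_ext with (Derive_n (Derive g) n).
    + intro t. apply Derive_n_Derive.
    + exact (IH (Derive g) H x Hx).
Qed.

Lemma diff_upto_pred (n : nat) (S : R -> Prop) (g : R -> R) :
  diff_upto (Datatypes.S n) S g -> diff_upto n S g.
Proof.
  revert g. induction n as [|n IH]; intros g; [easy|].
  intros [H0 H]. split; [exact H0|]. now apply IH.
Qed.

Lemma locally_eq_on (S : R -> Prop) (g h : R -> R) (x : R) :
  open S -> (forall t, S t -> g t = h t) -> S x ->
  locally x (fun t => g t = h t).
Proof. intros HS E Hx. apply (filter_imp S); [exact E|exact (HS x Hx)]. Qed.

(** As [S] is open, equality on [S] is equality near each of its points, and so passes to
    derivatives. *)
Lemma diff_upto_ext (n : nat) (S : R -> Prop) (g h : R -> R) :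
  open S -> (forall x, S x -> g x = h x) -> diff_upto n S g -> diff_upto n S h.
Proof.
  intros HS. revert g h. induction n as [|n IH]; intros g h E; [easy|].
  intros [H0 H]. split.
  - intros x Hx. apply ex_derive_ext_loc with g; [|auto].
    now apply locally_eq_on with S.
  - apply IH with (Derive g); [|exact H].
    intros x Hx. apply Derive_ext_loc. now apply locally_eq_on with S.
Qed.

Lemma diff_upto_const (n : nat) (S : R -> Prop) (c : R) :
  open S -> diff_upto n S (fun _ => c).
Proof.
  intros HS. revert c. induction n as [|n IH]; intros c; [easy|]. split.
  - intros x _. apply ex_derive_const.
  - apply diff_upto_ext with (fun _ => 0); auto.
    intros x _. now rewrite Derive_const.
Qed.

Lemma diff_upto_plus (n : nat) (S : R -> Prop) (g h : R -> R) :
  open S -> diff_upto n S g -> diff_upto n S h ->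
  diff_upto n S (fun x => g x + h x).
Proof.
  intros HS. revert g h. induction n as [|n IH]; intros g h; [easy|].
  intros [Hg0 Hg] [Hh0 Hh]. split.
  - intros x Hx. apply (ex_derive_plus g h); auto.
  - apply diff_upto_ext with (fun x => Derive g x + Derive h x); auto.
    intros x Hx. rewrite (Derive_plus g h); auto.
Qed.

Lemma diff_upto_mult (n : nat) (S : R -> Prop) (g h : R -> R) :
  open S -> diff_upto n S g -> diff_upto n S h ->
  diff_upto n S (fun x => g x * h x).
Proof.
  intros HS. revert g h. induction n as [|n IH]; intros g h; [easy|].
  intros Hg Hh.
  (* The product rule also contains [g] and [h] undifferentiated, which are needed at the lower
     order. *)
  assert (Hg' := diff_upto_pred _ _ _ Hg).
  assert (Hh' := diff_upto_pred _ _ _ Hh).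
  destruct Hg as [Hg0 Hg], Hh as [Hh0 Hh]. split.
  - intros x Hx. apply (ex_derive_mult g h); auto.
  - apply diff_upto_ext with (fun x => Derive g x * h x + g x * Derive h x); auto.
    + intros x Hx. rewrite (Derive_mult g h); auto.
    + apply diff_upto_plus; auto.
Qed.

Lemma diff_upto_inv (n : nat) (S : R -> Prop) (g : R -> R) :
  open S -> (forall x, S x -> g x <> 0) -> diff_upto n S g ->
  diff_upto n S (fun x => / g x).
Proof.
  intros HS Hn. induction n as [|n IH]; [easy|].
  intros Hg. assert (Hg' := diff_upto_pred _ _ _ Hg). destruct Hg as [Hg0 Hg]. split.
  - intros x Hx. apply (ex_derive_inv g); auto.
  - apply diff_upto_ext
      with (fun x => (-1) * Derive g x * (/ g x * / g x)); auto.
    + intros x Hx. rewrite Derive_inv; auto. field. auto.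
    + apply diff_upto_mult; auto; apply diff_upto_mult; auto using diff_upto_const.
Qed.

Lemma smooth_on_ex_derive (S : R -> Prop) (g : R -> R) (x : R) :
  smooth_on S g -> S x -> ex_derive g x.
Proof. intros H Hx. exact (H 1%nat x Hx). Qed.

Lemma smooth_on_ext (S : R -> Prop) (g h : R -> R) :
  open S -> (forall x, S x -> g x = h x) -> smooth_on S g -> smooth_on S h.
Proof.
  rewrite !smooth_on_diff_upto. intros HS E H n. now apply diff_upto_ext with g.
Qed.

Lemma smooth_on_const (S : R -> Prop) (c : R) :
  open S -> smooth_on S (fun _ => c).
Proof. rewrite smooth_on_diff_upto. auto using diff_upto_const. Qed.

Lemma smooth_on_plus (S : R -> Prop) (g h : R -> R) :
  open S -> smooth_on S g -> smooth_on S h -> smooth_on S (fun x => g x + h x).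
Proof. rewrite !smooth_on_diff_upto. auto using diff_upto_plus. Qed.

Lemma smooth_on_mult (S : R -> Prop) (g h : R -> R) :
  open S -> smooth_on S g -> smooth_on S h -> smooth_on S (fun x => g x * h x).
Proof. rewrite !smooth_on_diff_upto. auto using diff_upto_mult. Qed.

Lemma smooth_on_inv (S : R -> Prop) (g : R -> R) :
  open S -> (forall x, S x -> g x <> 0) -> smooth_on S g ->
  smooth_on S (fun x => / g x).
Proof. rewrite !smooth_on_diff_upto. auto using diff_upto_inv. Qed.

Lemma smooth_on_subset (S S' : R -> Prop) (g : R -> R) :
  (forall x, S' x -> S x) -> smooth_on S g -> smooth_on S' g.
Proof. intros Hs H n x Hx. auto. Qed.

Lemma smooth_on_div (S : R -> Prop) (g h : R -> R) :
  open S -> (forall x, S x -> h x <> 0) -> smooth_on S g -> smooth_on S h ->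
  smooth_on S (fun x => g x / h x).
Proof.
  intros. apply smooth_on_mult; auto. now apply smooth_on_inv.
Qed.

(** * Changes of variable and the transformed equation *)

Lemma mean_value_on (S : R -> Prop) (g : R -> R) (a b : R) :
  is_open_interval S -> (forall y, S y -> ex_derive g y) -> S a -> S b ->
  exists c, S c /\ g b - g a = Derive g c * (b - a).
Proof.
  intros HS Hg Ha Hb.
  assert (Hbtw := fun t => open_interval_between S a b t HS Ha Hb).
  destruct (MVT_gen g a b (Derive g)) as [c [Hc E]].
  - intros x Hx. apply Derive_correct, Hg, Hbtw. lra.
  - intros x Hx. apply derivable_continuous_pt, ex_derive_Reals_0, Hg, Hbtw, Hx.
  - exists c. split; [now apply Hbtw|exact E].
Qed.

(** By the mean value theorem, equal values at [a] and [b] force z'(c) (b - a) = 0 for some [c] in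
    [S], hence a = b. *)
Lemma change_of_variable_intro (S : R -> Prop) (z : R -> R) :
  is_open_interval S -> smooth_on S z -> (forall y, S y -> Derive z y <> 0) ->
  change_of_variable S z.
Proof.
  intros HS Hz Hn. split; [exact Hz|split; [|exact Hn]].
  intros a b Ha Hb E.
  destruct (mean_value_on S z a b) as [c [Hc Ec]]; auto.
  { intros y Hy. now apply smooth_on_ex_derive with S. }
  assert (H : Derive z c * (b - a) = 0) by lra.
  apply Rmult_integral in H. destruct H as [H|H]; [|lra].
  now destruct (Hn c Hc).
Qed.

Lemma Derive_comp_curve (z y : R -> R) (x : R) :
  ex_derive z (y x) -> ex_derive y x ->
  Derive (fun t => z (y t)) x = Derive z (y x) * Derive y x.
Proof.
  intros Hz Hy. rewrite (Derive_comp z y) by assumption. ring.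
Qed.

(** By the chain rule (z(y(x)))' = z'(y) y', so the condition on curves becomes a pointwise
    identity; testing it on straight lines suffices. *)
Lemma transforms_into_iff (I S : R -> Prop) (z : R -> R) (f g : R -> R -> R) :
  (forall y, S y -> ex_derive z y) -> (forall y, S y -> Derive z y <> 0) ->
  transforms_into I S z f g <->
  forall x y, I x -> S y -> Derive z y * f x y = g x (z y).
Proof.
  intros Hz Hn. split.
  - intros H x y Hx Hy.
    (* the curve through [(x, y)] with slope [f x y] *)
    set (c := fun t => y + f x y * (t - x)).
    assert (Hc : is_derive c x (f x y)).
    { unfold c. auto_derive; [easy|ring]. }
    assert (Ec : c x = y) by (unfold c; ring).
    assert (Hex : ex_derive c x) by (eexists; exact Hc).
    destruct (H c x Hx) as [H1 _]; rewrite ?Ec; auto.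
    rewrite (Derive_comp_curve z c) in H1 by (rewrite ?Ec; auto).
    rewrite (is_derive_unique _ _ _ Hc), Ec in H1. auto.
  - intros H y x Hx Hy Hex. rewrite (Derive_comp_curve z y) by auto.
    rewrite <- H by auto. split; intro E.
    + now rewrite E.
    + apply Rmult_eq_reg_l with (Derive z (y x)); auto.
Qed.

Lemma reducible_intro (I J K : R -> Prop) (f : R -> R -> R) (z p q : R -> R) :
  is_open_subinterval K J -> smooth_on K z ->
  (forall y, K y -> Derive z y <> 0) -> smooth_on I p -> smooth_on I q ->
  (forall x y, I x -> K y -> Derive z y * f x y = p x + q x * z y) ->
  reducible_to_linear I J f.
Proof.
  intros HK Hz Hn Hp Hq H. exists K, z, p, q. split; [exact HK|split]; [|do 2 (split; [assumption|])].
  - apply change_of_variable_intro; auto. apply HK.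
  - apply transforms_into_iff; auto.
    intros y Hy. now apply smooth_on_ex_derive with K.
Qed.

(** * Linearization from the Lie algebra relation *)

Lemma smooth_primitive (S : R -> Prop) (g : R -> R) :
  is_open_interval S -> smooth_on S g ->
  exists G, smooth_on S G /\ forall y, S y -> Derive G y = g y.
Proof.
  intros HS Hg. destruct (open_interval_inhabited S HS) as [a Ha].
  assert (Hc : forall y, S y -> continuous g y).
  { intros y Hy. apply (ex_derive_continuous g). now apply smooth_on_ex_derive with S. }
  assert (HG : forall y, S y -> is_derive (RInt g a) y (g y)).
  { intros y Hy. apply (is_derive_RInt g (RInt g a) a); auto.
    apply (filter_imp S); [|exact (open_interval_open S HS y Hy)].
    intros b Hb. apply (RInt_correct g), (ex_RInt_continuous g).
    intros t Ht. apply Hc. now apply open_interval_between with a b. }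
  assert (E : forall y, S y -> Derive (RInt g a) y = g y).
  { intros y Hy. apply is_derive_unique, HG, Hy. }
  exists (RInt g a). split; [|exact E].
  apply smooth_on_Derive. split.
  - intros y Hy. exists (g y). auto.
  - apply smooth_on_ext with g; auto using open_interval_open.
    intros y Hy. symmetry. auto.
Qed.

Lemma reducible_of_lie_nonzero (I J K : R -> Prop) (f : R -> R -> R)
    (T1 T2 xi1 xi2 : R -> R) :
  open I -> is_open_subinterval K J -> smooth_on I T1 -> smooth_on I T2 ->
  smooth_on K xi1 -> smooth_on K xi2 ->
  (forall x y, I x -> K y -> f x y = T1 x * xi1 y + T2 x * xi2 y) ->
  span_lie_algebra K xi1 xi2 -> (forall y, K y -> xi1 y <> 0) ->
  reducible_to_linear I J f.
Proof.
  intros HI HK HT1 HT2 Hx1 Hx2 Hf [al [be Hcom]] Hn.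
  assert (HKi := proj1 HK).
  assert (HKo := open_interval_open K HKi).
  set (u := fun y => xi2 y / xi1 y).
  assert (Hu : smooth_on K u) by now apply smooth_on_div.
  assert (Hud : forall y, K y -> ex_derive u y).
  { intros y Hy. now apply smooth_on_ex_derive with K. }
  (* The commutator coefficient is xi1^2 u', so the bracket relation divided by [xi1] is a
     first-order equation for [u]. *)
  assert (Eu : forall y, K y -> xi1 y * Derive u y = al + be * u y).
  { intros y Hy. unfold u at 1.
    rewrite Derive_div; try (apply smooth_on_ex_derive with K; assumption);
      [|now apply Hn].
    specialize (Hcom y Hy). unfold commutator in Hcom. unfold u.
    assert (Hny := Hn y Hy).
    apply Rmult_eq_reg_l with (xi1 y); [|assumption].
    transitivity (xi1 y * Derive xi2 y - xi2 y * Derive xi1 y);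
      [field; assumption|rewrite Hcom; field; assumption]. }
  assert (Ef : forall x y, I x -> K y -> f x y = (T1 x + T2 x * u y) * xi1 y).
  { intros x y Hx Hy. rewrite Hf by assumption. unfold u. field. auto. }
  destruct (classic (forall y, K y -> Derive u y = 0)) as [H0|H0].
  - destruct (open_interval_inhabited K HKi) as [y0 Hy0].
    assert (Hconst : forall y, K y -> u y = u y0).
    { intros y Hy. destruct (mean_value_on K u y0 y) as [c [Hc E]]; auto.
      rewrite H0 in E by assumption. lra. }
    destruct (smooth_primitive K (fun y => / xi1 y)) as [z [Hz Ez]]; auto.
    { now apply smooth_on_inv. }
    (* Since z' = 1 / xi1, z' f = T1 + T2 u with [u] constant. *)
    apply reducible_intro with K z (fun x => T1 x + T2 x * u y0) (fun _ => 0);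
      auto using smooth_on_const.
    + intros y Hy. rewrite Ez by assumption. apply Rinv_neq_0_compat. auto.
    + apply smooth_on_plus; auto. apply smooth_on_mult; auto using smooth_on_const.
    + intros x y Hx Hy. rewrite Ez, Ef, (Hconst y) by assumption. field. auto.
  - apply not_all_ex_not in H0. destruct H0 as [y0 H0].
    apply imply_to_and in H0. destruct H0 as [Hy0 H0].
    set (w := fun y => al + be * u y).
    assert (Hw : smooth_on K w).
    { apply smooth_on_plus; auto using smooth_on_const.
      apply smooth_on_mult; auto using smooth_on_const. }
    (* At [y0], w = xi1 u' and both factors are nonzero; by continuity [w] stays nonzero on some
       [L]. *)
    assert (Hw0 : w y0 <> 0).
    { unfold w. rewrite <- Eu by assumption.
      apply Rmult_integral_contrapositive. auto. }
    destruct (nonzero_open_subinterval K w y0) as [L [HL [_ Hwn]]]; auto.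
    { intros y Hy. now apply smooth_on_ex_derive with K. }
    assert (HLK := proj2 HL).
    assert (HLJ := open_subinterval_trans _ _ _ HL HK).
    assert (HLo := open_interval_open L (proj1 HL)).
    assert (Du : forall y, L y -> Derive u y = w y / xi1 y).
    { intros y Hy. unfold w. rewrite <- Eu by auto. field. auto. }
    assert (Dun : forall y, L y -> Derive u y <> 0).
    { intros y Hy. rewrite Du by assumption.
      apply Rmult_integral_contrapositive. auto using Rinv_neq_0_compat. }
    destruct (Req_dec be 0) as [Hbe|Hbe].
    (* Here [w] is the constant [al], so u' = al / xi1 and u' f = al (T1 + T2 u). *)
    + apply reducible_intro with L u (fun x => al * T1 x) (fun x => al * T2 x); auto.
      * now apply smooth_on_subset with K.
      * apply smooth_on_mult; auto using smooth_on_const.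
      * apply smooth_on_mult; auto using smooth_on_const.
      * intros x y Hx Hy. rewrite Du, Ef by auto. unfold w. rewrite Hbe. field. auto.
    (* Since w' = be u' and u' = w / xi1, (1 / w)' = - be u' / w^2 = - be / (xi1 w). *)
    + assert (Dz : forall y, L y ->
                Derive (fun y => / w y) y = - (be / (xi1 y * w y))).
      { intros y Hy.
        rewrite Derive_inv; auto; [|apply smooth_on_ex_derive with K; auto].
        unfold w at 1.
        rewrite Derive_plus, Derive_const, Derive_scal, Du; auto.
        - field. auto.
        - apply ex_derive_const.
        - apply ex_derive_scal. auto. }
      (* With z = 1 / w, z' f = - be (T1 + T2 u) / w; substituting be u = w - al gives - T2 + (al T2
         - be T1) z. *)
      apply reducible_intro with L (fun y => / w y) (fun x => (-1) * T2 x)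
        (fun x => al * T2 x + (- be) * T1 x); auto.
      * apply smooth_on_inv; auto. now apply smooth_on_subset with K.
      * intros y Hy. rewrite Dz by assumption. apply Ropp_neq_0_compat.
        apply Rmult_integral_contrapositive. split; [assumption|].
        apply Rinv_neq_0_compat, Rmult_integral_contrapositive. auto.
      * apply smooth_on_mult; auto using smooth_on_const.
      * apply smooth_on_plus; auto; apply smooth_on_mult; auto using smooth_on_const.
      * intros x y Hx Hy. rewrite Dz, Ef by auto.
        assert (Hu' : u y = (w y - al) / be) by (unfold w; field; assumption).
        rewrite Hu'. field. auto.
Qed.

Lemma span_lie_algebra_subset (S S' : R -> Prop) (xi1 xi2 : R -> R) :
  (forall y, S' y -> S y) -> span_lie_algebra S xi1 xi2 ->
  span_lie_algebra S' xi1 xi2.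
Proof. intros Hs [al [be H]]. exists al, be. auto. Qed.

(** The commutator is antisymmetric, so the coefficients change sign and trade places. This allows
    the nonvanishing field to be taken first. *)
Lemma span_lie_algebra_sym (S : R -> Prop) (xi1 xi2 : R -> R) :
  span_lie_algebra S xi1 xi2 -> span_lie_algebra S xi2 xi1.
Proof.
  intros [al [be H]]. exists (- be), (- al). intros y Hy.
  specialize (H y Hy). unfold commutator in *. lra.
Qed.

(** By continuity [xi1] has no zero on some subinterval around [y0], and the remaining hypotheses
    restrict to it. *)
Lemma reducible_of_lie_at (I J K : R -> Prop) (f : R -> R -> R)
    (T1 T2 xi1 xi2 : R -> R) (y0 : R) :
  open I -> is_open_subinterval K J -> smooth_on I T1 -> smooth_on I T2 ->
  smooth_on K xi1 -> smooth_on K xi2 ->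
  (forall x y, I x -> K y -> f x y = T1 x * xi1 y + T2 x * xi2 y) ->
  span_lie_algebra K xi1 xi2 -> K y0 -> xi1 y0 <> 0 ->
  reducible_to_linear I J f.
Proof.
  intros HI HK HT1 HT2 Hx1 Hx2 Hf Hlie Hy0 H0.
  destruct (nonzero_open_subinterval K xi1 y0) as [L [HL [_ Hn]]]; auto.
  { apply HK. }
  { intros y Hy. now apply smooth_on_ex_derive with K. }
  assert (HLK := proj2 HL).
  apply reducible_of_lie_nonzero with L T1 T2 xi1 xi2; auto.
  - now apply open_subinterval_trans with K.
  - now apply smooth_on_subset with K.
  - now apply smooth_on_subset with K.
  - now apply span_lie_algebra_subset with K.
Qed.

(** * The Lie algebra of a linearizable equation *)

Lemma lie_representation_of_reducible (I J : R -> Prop) (f : R -> R -> R) :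
  reducible_to_linear I J f -> has_lie_representation I J f.
Proof.
  intros [K [z [p [q [HK [[Hz [_ Hn]] [Hp [Hq Htr]]]]]]]].
  assert (HKo := open_interval_open K (proj1 HK)).
  assert (Hzd : forall y, K y -> ex_derive z y).
  { intros y Hy. now apply smooth_on_ex_derive with K. }
  rewrite transforms_into_iff in Htr by auto.
  assert (Hz' := proj2 (proj1 (smooth_on_Derive K z) Hz)).
  assert (Hz'd : forall y, K y -> ex_derive (Derive z) y).
  { intros y Hy. now apply smooth_on_ex_derive with K. }
  exists K, p, q, (fun y => / Derive z y), (fun y => z y / Derive z y).
  split; [exact HK|]. do 2 (split; [assumption|]).
  split; [now apply smooth_on_inv|]. split; [now apply smooth_on_div|]. split.
  - intros x y Hx Hy.
    apply Rmult_eq_reg_l with (Derive z y); auto.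
    rewrite Htr by assumption. field. auto.
  (* The algebra is always two-dimensional here: z' is nonzero, so 1 and [z] are linearly
     independent, and so are 1 / z' and z / z'. *)
  - left. split.
    + exists 1, 0. intros y Hy. unfold commutator.
      rewrite Derive_div, Derive_inv by auto. field. auto.
    + intros [c1 [c2 [Hc H]]].
      assert (H' : forall y, K y -> c1 + c2 * z y = 0).
      { intros y Hy. apply Rmult_eq_reg_l with (/ Derive z y).
        - rewrite Rmult_0_r, <- (H y Hy). field. auto.
        - apply Rinv_neq_0_compat. auto. }
      destruct (open_interval_inhabited K (proj1 HK)) as [y0 Hy0].
      assert (D : c2 * Derive z y0 = 0).
      (* On [K] the function c2 z equals the constant - c1, so both have the same derivative; 0 is
         written as the derivative of that constant. *)
      { rewrite <- Derive_scal. rewrite <- (Derive_const (- c1) y0).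
        apply Derive_ext_loc. apply locally_eq_on with K; auto.
        intros y Hy. specialize (H' y Hy). lra. }
      apply Rmult_integral in D. destruct D as [D|D]; [|now apply (Hn y0)].
      specialize (H' y0 Hy0). rewrite D in H'. destruct Hc; lra.
Qed.

Theorem theorem1p2p1 (I J : R -> Prop) (f : R -> R -> R)
    (hI : is_open_interval I) (hJ : is_open_interval J)
    (hf : smooth2_on I J f) :
  reducible_to_linear I J f <-> has_lie_representation I J f.
Proof.
  split; [apply lie_representation_of_reducible|].
  intros [K [T1 [T2 [xi1 [xi2 [HK [HT1 [HT2 [Hx1 [Hx2 [Hf Hlie]]]]]]]]]]].
  assert (HI := open_interval_open I hI).
  (* Both cases provide a point where one field is nonzero: if both vanished on [K], the combination
     with coefficients 1 and 0 would be a linear dependence. *)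
  assert (H : span_lie_algebra K xi1 xi2 /\
              exists y, K y /\ (xi1 y <> 0 \/ xi2 y <> 0)).
  { destruct Hlie as [[Hs Hind]|[Hs [_ Hex]]]; split; trivial.
    apply NNPP. intro Hno. apply Hind. exists 1, 0. split; [left; lra|].
    intros y Hy. destruct (Req_dec (xi1 y) 0) as [E|E]; [rewrite E; ring|].
    destruct Hno. exists y. auto. }
  destruct H as [Hs [y0 [Hy0 [H0|H0]]]].
  - now apply reducible_of_lie_at with K T1 T2 xi1 xi2 y0.
  (* When only [xi2] is known to be nonzero at [y0], the two terms of the representation are
     exchanged. *)
  - apply reducible_of_lie_at with K T2 T1 xi2 xi1 y0; auto.
    + intros x y Hx Hy. rewrite Hf by assumption. ring.
    + now apply span_lie_algebra_sym.
Qed.
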